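(* Let $d\ge 1$, let $\mathcal{M}_1,\dots,\mathcal{M}_d$ be reversible Markov chains on state spaces $\Sigma_1,\dots,\Sigma_d$ with stationary distributions $\pi_1,\dots,\pi_d$, let $\omega:\Sigma_1\times\dots\times\Sigma_d\to\mathbb{R}$ be a label function, let $k\ge 0$ be an integer and let $\varepsilon>0$. Suppose that $\sigma_0^1,\dots,\sigma_0^d$ are chosen independently with $\sigma_0^s\sim\pi_s$. For each $s=1,\dots,d$, consider two independent trajectories $Y^s_0,Y^s_1,\dots$ and $Z^s_0,Z^s_1,\dots$ of $\mathcal{M}_s$ from $Y^s_0=Z^s_0=\sigma^s_0$, all trajectories for different $s$ being independent of each other. Write $\boldsymbol{\sigma}_0=(\sigma_0^1,\dots,\sigma_0^d)$, and let $\mathbf{Z}_{\boldsymbol{\sigma}_0,k}$ be the (random) collection of all $(2k+1)^d$ vectors $(a_1,\dots,a_d)$ such that for each $i$, $a_i$ is one of the $2k+1$ entries of the list $(\sigma_0^i,Y^i_1,\dots,Y^i_{k},Z^i_1,\dots,Z^i_{k})$. Then $$\Pr\big(\omega(\boldsymbol{\sigma}_0)\text{ is an }\varepsilon\text{-outlier among }\omega(\mathbf{x}),\ \mathbf{x}\in\mathbf{Z}_{\boldsymbol{\sigma}_0,k}\big)\le 2^d\cdot\varepsilon.$$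
   Context: Markov chains are time-homogeneous, discrete-time, on discrete (finite or countable) state spaces, specified by transition probabilities $P(\sigma,\tau)$. A trajectory of a chain is a sequence $X_0,X_1,X_2,\dots$ of random variables with $\Pr(X_i=\sigma_i\mid X_{i-1}=\sigma_{i-1},\dots,X_0=\sigma_0)=P(\sigma_{i-1},\sigma_i)$. A trajectory is $\pi$-stationary if $X_0\sim\pi$, where $\pi$ is a stationary distribution. A chain is reversible (with respect to $\pi$) if every $\pi$-stationary trajectory $X_0,\dots,X_n$ has the same distribution as its reverse $X_n,\dots,X_0$. A real number $a_0$ is an $\varepsilon$-outlier among a finite list $a_0,\dots,a_N$ if $\#\{i\in\{0,\dots,N\}: a_i\le a_0\}\le \varepsilon(N+1)$. The collection $\mathbf{Z}_{\boldsymbol{\sigma}_0,k}$ is indexed by the $(2k+1)^d$ choices of list positions, so its elements are counted with multiplicity; the entry in which every coordinate is taken at the position of $\sigma_0^i$ is $\boldsymbol{\sigma}_0$. *)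

(* Defs.v *)
From HB Require Import structures.
From mathcomp Require Import all_boot all_order all_algebra.
From mathcomp Require Import all_classical all_reals all_analysis.

Set Implicit Arguments.
Unset Strict Implicit.
Unset Printing Implicit Defensive.

Import Order.TTheory GRing.Theory Num.Theory.

Local Open Scope classical_set_scope.
Local Open Scope ring_scope.

Record markov_chain (R : realType) (T : countType) := MarkovChain {
  trans :> T -> T -> R ;
  trans_ge0 : forall a b, 0 <= trans a b ;
  trans_sum1 : forall a, \esum_(b in [set: T]) (trans a b)%:E = 1%E }.

Definition stationary_distribution (R : realType) (T : countType)
    (M : markov_chain R T) (pi : T -> R) : Prop :=
  [/\ forall a, 0 <= pi a,
      \esum_(a in [set: T]) (pi a)%:E = 1%E &
      forall b, \esum_(a in [set: T]) (pi a * M a b)%:E = (pi b)%:E].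

Section probability_space.
Context {disp : measure_display} {Omega : measurableType disp} {R : realType}.
Variable P : probability Omega R.

(* Measurability for the discrete sigma-algebra on T. The library's {RV P >-> T}
   would require T to be pointed and to carry a measurable structure. *)
Definition discrete_rv (T : countType) (X : Omega -> T) : Prop :=
  forall B : set T, measurable (X @^-1` B).

Definition has_law (T : countType) (X : Omega -> T) (pi : T -> R) : Prop :=
  forall a, P (X @^-1` [set a]) = (pi a)%:E.

(* Only meaningful when P B != 0. *)
Definition cond_prob (A B : set Omega) : R :=
  fine (P (A `&` B)) / fine (P B).

Definition path_event (T : countType) (X : nat -> Omega -> T) (n : nat)
    (x : nat -> T) : set Omega :=
  [set w | forall i, (i <= n)%N -> X i w = x i].

(* X 0, ..., X n is a trajectory of M; the variables X i with i > n are not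
   constrained. *)
Definition trajectory (T : countType) (M : markov_chain R T) (n : nat)
    (X : nat -> Omega -> T) : Prop :=
  (forall i, (i <= n)%N -> discrete_rv (X i)) /\
  (forall (i : nat) (x : nat -> T), (i < n)%N -> P (path_event X i x) != 0%E ->
     cond_prob (X i.+1 @^-1` [set x i.+1]) (path_event X i x)
     = M (x i) (x i.+1)).

Definition process_events (T : countType) (X : nat -> Omega -> T) :
    set (set Omega) :=
  \bigcup_i preimage_set_system [set: Omega] (X i) [set: set T].

Definition mutually_independent (I : finType) (F : I -> set (set Omega)) :
    Prop :=
  forall (J : {set I}) (E : I -> set Omega), (forall i, i \in J -> F i (E i)) ->
    P (\bigcap_(i in [set` J]) E i) = (\prod_(i in J) fine (P (E i)))%:E.

Definition cond_independent (T : countType) (X : Omega -> T)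
    (F G : set (set Omega)) : Prop :=
  forall (a : T) (A B : set Omega), P (X @^-1` [set a]) != 0%E ->
    F A -> G B ->
    cond_prob (A `&` B) (X @^-1` [set a])
    = cond_prob A (X @^-1` [set a]) * cond_prob B (X @^-1` [set a]).

End probability_space.

Definition reversible (R : realType) (T : countType) (M : markov_chain R T)
    (pi : T -> R) : Prop :=
  forall (disp : measure_display) (Omega : measurableType disp)
    (P : probability Omega R) (n : nat) (X : nat -> Omega -> T),
  trajectory P M n X -> has_law P (X 0%N) pi ->
  forall x : nat -> T,
    P (path_event X n x) = P (path_event (fun i => X (n - i)%N) n x).

Definition outlier (R : realType) (eps a0 : R) (s : seq R) : bool :=
  (count (fun a => a <= a0) s)%:R <= eps * (size s)%:R.

(* The list (x, y_1, ..., y_k, z_1, ..., z_k); y 0 and z 0 are not used. *)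
Definition entries (T : Type) (k : nat) (x : T) (y z : nat -> T) : seq T :=
  x :: [seq y j | j <- iota 1 k] ++ [seq z j | j <- iota 1 k].

(* One vector for each choice f of a position in every list, so that vectors
   are repeated according to their multiplicity; all positions are in range. *)
Definition choice_vectors (d : nat) (Sigma : 'I_d -> countType) (k : nat)
    (x : forall s, Sigma s) (y z : forall s, nat -> Sigma s) :
    seq (forall s, Sigma s) :=
  [seq (fun s => nth (x s) (entries k (x s) (y s) (z s)) (f s))
     | f : {ffun 'I_d -> 'I_(2 * k + 1)}].

(* Main.v *)
(* For j in {0,...,k}^d, splice for each s the reversed Y^s from time j_s with
   Z^s up to time k - j_s. By reversibility this yields d independent stationary
   trajectories of length k, so the law of the resulting (k+1)^d grid of vectors
   does not depend on j, while sigma_0 sits at position j of the grid. The grid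
   is part of the (2k+1)^d vectors, so if sigma_0 is an outlier, its rank in the
   grid is at most c = eps (2k+1)^d. A grid has at most c positions of rank at
   most c, so summing over all j bounds the probability of an outlier by
   c / (k+1)^d <= 2^d eps. *)
Require Import Defs.
From HB Require Import structures.
From mathcomp Require Import all_boot all_order all_algebra.
From mathcomp Require Import all_classical all_reals all_analysis.
From mathcomp Require Import measurable_realfun zify.

Set Implicit Arguments.
Unset Strict Implicit.
Unset Printing Implicit Defensive.

Import Order.TTheory GRing.Theory Num.Theory.

Local Open Scope classical_set_scope.
Local Open Scope ring_scope.

(** * Laws of discrete variables and probabilities of paths *)

Section discrete_laws.
Context {disp : measure_display} {Omega : measurableType disp} {R : realType}.
Variable P : probability Omega R.

Lemma path_event_bigcap (T : countType) (X : nat -> Omega -> T) (n : nat)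
    (x : nat -> T) :
  path_event X n x = \bigcap_(i in `I_n.+1) (X i @^-1` [set x i]).
Proof. by []. Qed.

Lemma measurable_path_event (T : countType) (X : nat -> Omega -> T) (n : nat)
    (x : nat -> T) :
  (forall i, (i <= n)%N -> discrete_rv (X i)) -> measurable (path_event X n x).
Proof.
move=> mX; rewrite path_event_bigcap; apply: fin_bigcap_measurable => // i.
by move=> /= ilt; apply: mX.
Qed.

(** [G] is left arbitrary to cover both the sigma-algebra of a single process and the joint one
    generated by [Y] and [Z]. *)
Lemma path_event_process (T : countType) (X : nat -> Omega -> T) (n : nat)
    (x : nat -> T) (G : set (set Omega)) :
  process_events X `<=` G -> <<s G >> (path_event X n x).
Proof.
move=> XG; rewrite path_event_bigcap.
apply: (@fin_bigcap_measurable _ (g_sigma_algebraType G)) => // i _.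
apply: sub_sigma_algebra; apply: XG; exists i => //.
by exists [set x i] => //; rewrite setTI.
Qed.

Lemma discrete_rv_points (T : countType) (X : Omega -> T) :
  (forall a, measurable (X @^-1` [set a])) -> discrete_rv X.
Proof.
move=> mX B.
have -> : X @^-1` B = \bigcup_(a in [set: T]) (X @^-1` ([set a] `&` B)).
  rewrite -preimage_bigcup; congr (_ @^-1` _); apply/seteqP; split=> [a Ba|a].
    by exists a.
  by case=> b _ [].
apply: countable_bigcupT_measurable; first exact: countableP.
move=> a; have [aB|aB] := pselect (B a).
  by rewrite (_ : [set a] `&` B = [set a]); [exact: mX|apply/setIidl => _ ->].
rewrite (_ : [set a] `&` B = set0) ?preimage_set0; first exact: measurable0.
by rewrite -subset0 => _ [->].
Qed.

Lemma discrete_rv_dffun (I : finType) (T : I -> countType)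
    (X : forall i, Omega -> T i) :
  (forall i, discrete_rv (X i)) ->
  discrete_rv (fun w => [ffun i => X i w] : {dffun forall i, T i}).
Proof.
move=> mX; apply: discrete_rv_points => a.
rewrite (_ : _ @^-1` _ = \bigcap_(i in [set: I]) (X i @^-1` [set a i])).
  by apply: fin_bigcap_measurable => // i _; apply: mX.
apply/seteqP; split=> [w <- i _|w Xa] /=; first by rewrite ffunE.
by apply/ffunP => i; rewrite ffunE; apply: Xa.
Qed.

Lemma discrete_rv_ffun (I : finType) (T : countType) (X : I -> Omega -> T) :
  (forall i, discrete_rv (X i)) ->
  discrete_rv (fun w => [ffun i => X i w]).
Proof.
move=> mX; apply: discrete_rv_points => a.
rewrite (_ : _ @^-1` _ = \bigcap_(i in [set: I]) (X i @^-1` [set a i])).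
  by apply: fin_bigcap_measurable => // i _; apply: mX.
apply/seteqP; split=> [w <- i _|w Xa] /=; first by rewrite ffunE.
by apply/ffunP => i; rewrite ffunE; apply: Xa.
Qed.

(** Countable additivity over the fibres [D n] of [pickle] in [B]; injectivity of [pickle] leaves at
    most one point in each fibre. *)
Lemma eq_discrete_law (T : countType) (X X' : Omega -> T) (B : set T) :
  discrete_rv X -> discrete_rv X' ->
  (forall a, P (X @^-1` [set a]) = P (X' @^-1` [set a])) ->
  P (X @^-1` B) = P (X' @^-1` B).
Proof.
move=> mX mX' XX'.
pose D n := [set a | B a /\ pickle a = n].
have DE (W : Omega -> T) : W @^-1` B = \bigcup_n (W @^-1` D n).
  rewrite -preimage_bigcup; congr (_ @^-1` _).
  by apply/seteqP; split=> [a Ba|a [n _ []]//]; exists (pickle a).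
have tD (W : Omega -> T) : trivIset setT (fun n => W @^-1` D n).
  apply/trivIsetP => m n _ _ mn; rewrite -subset0 => w [] [_ pm] [_ pn].
  by move: mn; rewrite -pm -pn eqxx.
rewrite !DE !measure_bigcup //; apply: eq_eseriesr => n _.
have [[a [Ba an]]|nD] := pselect (exists a, D n a).
  suff -> : D n = [set a] by exact: XX'.
  apply/seteqP; split=> [b [_ bn]|_ -> //].
  by apply: (pcan_inj (@pickleK T)); rewrite bn.
suff -> : D n = set0 by rewrite !preimage_set0.
by rewrite -subset0 => a Da; apply: nD; exists a.
Qed.

(** The sum of the probabilities is the expected number of events that occur, so the pointwise bound
    is integrated over a space of mass one. *)
Lemma sum_probability_le (I : finType) (E : I -> set Omega) (c : R) :
  (forall i, measurable (E i)) ->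
  (forall w, (\sum_i \1_(E i) w) <= c) ->
  (\sum_i P (E i) <= c%:E)%E.
Proof.
move=> mE Ec.
under eq_bigr do rewrite -[E _]setIT -integral_indic//.
rewrite -ge0_integral_sum //; last first.
  by move=> i; apply/measurable_EFinP; apply: measurable_indic.
have -> : c%:E = (\int[P]_(x in setT) (cst c%:E x))%E.
  rewrite integral_cst// -[LHS]mule1; congr (_ * _)%E.
  by symmetry; exact: probability_setT.
apply: ge0_le_integral => //.
- by move=> w _; apply: sume_ge0 => i _; rewrite lee_fin.
- apply: emeasurable_sum => i.
  by apply/measurable_EFinP; apply: measurable_indic.
- by move=> w _; rewrite sumEFin lee_fin.
Qed.

Lemma trajectory_path_prob (T : countType) (M : markov_chain R T) (pi : T -> R)
    (n : nat) (X : nat -> Omega -> T) (x : nat -> T) :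
  trajectory P M n X -> has_law P (X 0%N) pi ->
  P (path_event X n x) = (pi (x 0%N) * \prod_(i < n) M (x i) (x i.+1))%:E.
Proof.
move=> + law; elim: n => [_|n IH [mX step]].
  rewrite big_ord0 mulr1 -law; congr (P _); apply/seteqP; split=> [w|w Xw i].
    by apply.
  by rewrite leqn0 => /eqP ->.
have mpe m : (m <= n.+1)%N -> measurable (path_event X m x).
  move=> mn; apply: measurable_path_event => i im.
  exact: mX (leq_trans im mn).
have {}IH := IH (conj (fun i im => mX i (leqW im))
                      (fun i x im => step i x (leqW im))).
have E : path_event X n.+1 x
    = X n.+1 @^-1` [set x n.+1] `&` path_event X n x.
  apply/seteqP; split=> [w Xw|w [Xn Xw] i].
    by split; [exact: Xw|move=> i im; apply: Xw (leqW im)].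
  by rewrite leq_eqVlt => /predU1P[->//|]; exact: Xw.
rewrite big_ord_recr /= mulrA EFinM -IH.
(* A transition is prescribed only after a past of positive probability. After a null past both
   sides vanish, since the longer path event lies in the shorter one. *)
have [P0|P0] := eqVneq (P (path_event X n x)) 0%E.
  rewrite P0 mul0e; apply/eqP; rewrite eq_le measure_ge0 andbT -P0.
  by apply: le_measure; rewrite ?inE; [exact: mpe..|rewrite E; exact: subIsetr].
have := step n x (leqnn _) P0; rewrite /cond_prob -E => <-.
have fin m : (m <= n.+1)%N -> P (path_event X m x) \is a fin_num.
  by move=> mn; apply: fin_num_measure; exact: mpe.
have /EFin_fin_numP[p pE] := fin n (leqnSn n).
have /EFin_fin_numP[q ->] := fin n.+1 (leqnn _).
by move: P0; rewrite pE eqe /= => p0; rewrite -EFinM mulrC divfK.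
Qed.

End discrete_laws.

(** * Splicing a reversed trajectory with a forward one *)

Definition splice (T : Type) (j : nat) (y z : nat -> T) (i : nat) : T :=
  if (i <= j)%N then y (j - i)%N else z (i - j)%N.

Section windows.
Context {disp : measure_display} {Omega : measurableType disp} {R : realType}.
Variable P : probability Omega R.

Lemma splice_path_event (T : countType) (Y Z : nat -> Omega -> T) (j k : nat)
    (v : nat -> T) : (j <= k)%N -> Y 0%N = Z 0%N ->
  path_event (fun i w => splice j (Y^~ w) (Z^~ w) i) k v
  = path_event Y j (fun i => v (j - i)%N)
    `&` path_event Z (k - j) (fun i => v (j + i)%N).
Proof.
move=> jk YZ; apply/seteqP; split=> [w H|w [HY HZ] i ik].
  split=> i ij.
    have ji : (j - i <= j)%N by exact: leq_subr.
    by rewrite -(H _ (leq_trans ji jk)) /splice ji subKn.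
  have ik : (j + i <= k)%N by rewrite -leq_subRL.
  (* Time [j] of the splice is read from [Y] alone; the equality of [Y] and [Z] at time 0 supplies
     the first constraint on [Z]. *)
  rewrite -(H _ ik) /splice addKn; case: i {ij ik} => [|i].
    by rewrite addn0 leqnn subnn YZ.
  by rewrite leqNgt addnS ltnS leq_addr.
rewrite /splice; case: leqP => ij; first by rewrite HY ?leq_subr// subKn.
by rewrite HZ ?leq_sub2r// subnKC// ltnW.
Qed.

(** Reindexing by [n - i] moves the reversal in [reversible] from the process onto the prescribed
    path. *)
Lemma reversible_path_prob (T : countType) (M : markov_chain R T)
    (pi : T -> R) (n : nat) (X : nat -> Omega -> T) (x : nat -> T) :
  reversible M pi -> trajectory P M n X -> has_law P (X 0%N) pi ->
  P (path_event X n (fun i => x (n - i)%N)) = P (path_event X n x).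
Proof.
move=> rev tX lX; rewrite (rev _ _ P n X tX lX); congr (P _).
apply/seteqP; split=> w H i ni; last by apply: H; rewrite leq_subr.
by have := H (n - i)%N (leq_subr _ _); rewrite subKn.
Qed.

(** Given [X = v j], the two halves are independent. Reversibility turns the first into a forward
    path from [v 0] to [v j], the second starts at [v j], and dividing by [pi (v j)] glues the two
    products into one that no longer involves [j]. *)
Lemma splice_prob (T : countType) (M : markov_chain R T) (pi : T -> R)
    (X : Omega -> T) (Y Z : nat -> Omega -> T) (j k : nat) (v : nat -> T) :
  reversible M pi -> has_law P X pi ->
  (forall n, trajectory P M n Y) -> (forall n, trajectory P M n Z) ->
  Y 0%N = X -> Z 0%N = X ->
  cond_independent P X <<s process_events Y >> <<s process_events Z >> ->
  (j <= k)%N ->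
  P (path_event (fun i w => splice j (Y^~ w) (Z^~ w) i) k v)
  = (pi (v 0%N) * \prod_(i < k) M (v i) (v i.+1))%:E.
Proof.
move=> rev lX tY tZ Y0 Z0 ci jk.
rewrite splice_path_event ?Y0 ?Z0//.
set A := path_event Y _ _; set B := path_event Z _ _.
have lY : has_law P (Y 0%N) pi by rewrite Y0.
have lZ : has_law P (Z 0%N) pi by rewrite Z0.
have PA : P A = (pi (v 0%N) * \prod_(i < j) M (v i) (v i.+1))%:E.
  rewrite (reversible_path_prob _ rev (tY j) lY).
  exact: trajectory_path_prob (tY j) lY.
have PB := trajectory_path_prob (fun i => v (j + i)%N) (tZ (k - j)%N) lZ.
rewrite -/B addn0 in PB.
(* Both halves fix [X] through their time 0, so intersecting them with the conditioning event
   changes nothing. *)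
have AX : A `<=` X @^-1` [set v j].
  by move=> w /(_ 0%N (leq0n _)); rewrite Y0 subn0.
have BX : B `<=` X @^-1` [set v j].
  by move=> w /(_ 0%N (leq0n _)); rewrite Z0 addn0.
have mA : measurable A by apply: measurable_path_event => i; apply: (tY j).1.
have mB : measurable B by apply: measurable_path_event => i; apply: (tZ _).1.
have mX : measurable (X @^-1` [set v j]) by rewrite -Y0; apply: (tY 0%N).1.
have -> : \prod_(i < k) M (v i) (v i.+1) =
    (\prod_(i < j) M (v i) (v i.+1)) *
    \prod_(i < k - j) M (v (j + i)%N) (v (j + i.+1)%N).
  rewrite -(big_mkord xpredT (fun i => M (v i) (v i.+1))).
  rewrite (big_cat_nat _ (n := j))//=.
  rewrite big_mkord; congr (_ * _); rewrite -{1}[j]add0n big_addn big_mkord.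
  by apply: eq_bigr => i _; rewrite addnS addnC.
rewrite mulrA EFinM -PA.
(* If [pi (v j)] is zero no conditioning is possible, but [A] and its intersection with [B] are then
   null as subsets of a null event. *)
have [p0|p0] := eqVneq (pi (v j)) 0.
  have le0 C : measurable C -> C `<=` X @^-1` [set v j] -> P C = 0%E.
    move=> mC CX; apply/eqP; rewrite eq_le measure_ge0 andbT.
    have <- : P (X @^-1` [set v j]) = 0%E by rewrite lX p0.
    by apply: le_measure; rewrite ?inE.
  by rewrite !le0 ?mul0e//; [exact: measurableI|move=> w [/AX]].
have := ci (v j) A B; rewrite /cond_prob lX eqe => /(_ p0).
move=> /(_ (path_event_process _ _ (fun E => id))).
move=> /(_ (path_event_process _ _ (fun E => id))).
rewrite setIidl; last by move=> w [/AX].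
rewrite (setIidl AX) (setIidl BX) PB /=.
have /EFin_fin_numP[q ->] : P (A `&` B) \is a fin_num.
  by apply: fin_num_measure; exact: measurableI.
rewrite PA -EFinM /= => H; congr EFin.
by apply: (mulIf (invr_neq0 p0)); rewrite H [pi (v j) * _]mulrC mulfK// mulrAC.
Qed.

End windows.

(** * Ranks, and positions of spliced trajectories in the entry lists *)

(* The index maximizing [f] among those of rank at most [c] has a rank that
   counts all of them. *)
Lemma card_rank_le (I : finType) (R : realType) (f : I -> R) (c : R) :
  0 <= c ->
  #|[pred j | #|[pred i | f i <= f j]|%:R <= c]|%:R <= c.
Proof.
move=> c0; set S := [pred j | _]; have [j0 j0S|S0] := pickP S; last first.
  by rewrite eq_card0.
case: (@arg_maxP _ _ _ j0 S f j0S) => j jS jmax.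
apply: le_trans (jS); rewrite ler_nat.
by apply: subset_leq_card; apply/fintype.subsetP => i /jmax.
Qed.

(** Position 0 holds [x], which is [y 0], so positions 0 to [k] list [y]. Position [k + 1] holds
    [z 1], hence the offset [i - k]. *)
Lemma nth_entries (T : Type) (k : nat) (x : T) (y z : nat -> T) (i : nat) :
  y 0%N = x -> (i < 2 * k + 1)%N ->
  nth x (entries k x y z) i = if (i <= k)%N then y i else z (i - k)%N.
Proof.
move=> y0; case: i => [//|i]; rewrite addn1 ltnS mul2n -addnn => ik /=.
rewrite nth_cat size_map size_iota; case: ltnP => ki.
  by rewrite (nth_map 0%N) ?size_iota// nth_iota// add1n.
have ik' : (i - k < k)%N by rewrite ltn_subLR.
by rewrite (nth_map 0%N) ?size_iota// nth_iota// add1n subSn.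
Qed.

(** Position in the list [entries k x y z] at which the value [splice j y z i] stands. *)
Definition splice_pos (k j i : nat) : nat :=
  if (i <= j)%N then (j - i)%N else (k + (i - j))%N.

Lemma splice_pos_lt (k j i : nat) :
  (j <= k)%N -> (i <= k)%N -> (splice_pos k j i < 2 * k + 1)%N.
Proof. by move=> jk ik; rewrite /splice_pos; case: (leqP i j); lia. Qed.

(** The [y] branch lands at or below [j], hence at or below [k], and the [z] branch strictly above
    [k], so the branches cannot collide. *)
Lemma splice_pos_inj (k j i i' : nat) :
  (j <= k)%N -> splice_pos k j i = splice_pos k j i' -> i = i'.
Proof.
by move=> jk; rewrite /splice_pos; case: (leqP i j); case: (leqP i' j); lia.
Qed.

Lemma nth_splice_pos (T : Type) (k j i : nat) (x : T) (y z : nat -> T) :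
  y 0%N = x -> (j <= k)%N -> (i <= k)%N ->
  nth x (entries k x y z) (splice_pos k j i) = splice j y z i.
Proof.
move=> y0 jk ik; rewrite nth_entries ?splice_pos_lt// /splice_pos /splice.
case: (leqP i j) => ij; first by rewrite (leq_trans (leq_subr _ _) jk).
by rewrite leqNgt -[X in (X < _)%N]addn0 ltn_add2l subn_gt0 ij /= addKn.
Qed.

Lemma count_finite_enum (T : finType) (p : pred T) :
  count p (Finite.enum T) = #|p|.
Proof. by rewrite cardE -size_filter. Qed.

(** The grid embeds injectively into the choices of positions, so the rank within the grid is at
    most the rank among all (2k+1)^d vectors. *)
Lemma outlier_splice_rank (R : realType) (d : nat)
    (Sigma : 'I_d -> countType) (omega : (forall s, Sigma s) -> R) (k : nat)
    (eps : R) (x : forall s, Sigma s) (y z : forall s, nat -> Sigma s)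
    (j : {ffun 'I_d -> 'I_k.+1}) :
  (forall s, y s 0%N = x s) ->
  outlier eps (omega x) [seq omega v | v <- choice_vectors k x y z] ->
  #|[pred i : {ffun 'I_d -> 'I_k.+1} |
      omega (fun s => splice (j s) (y s) (z s) (i s))
      <= omega (fun s => splice (j s) (y s) (z s) (j s))]|%:R
  <= eps * (2 * k + 1)%:R ^+ d.
Proof.
move=> y0; rewrite /outlier size_map size_map -cardE card_ffun !card_ord natrX.
apply: le_trans; rewrite ler_nat !count_map count_finite_enum.
pose pos (i : {ffun 'I_d -> 'I_k.+1}) : {ffun 'I_d -> 'I_(2 * k + 1)} :=
  [ffun s => Ordinal (@splice_pos_lt k _ _ (ltn_ord (j s)) (ltn_ord (i s)))].
have posE i s : nth (x s) (entries k (x s) (y s) (z s)) (pos i s)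
    = splice (j s) (y s) (z s) (i s).
  rewrite ffunE /= nth_splice_pos//; first exact: ltn_ord (j s).
  exact: ltn_ord (i s).
have pos_inj : injective pos.
  move=> i i' /ffunP H; apply/ffunP => s; apply/val_inj.
  move: (H s); rewrite !ffunE => /(congr1 val) /=.
  by apply: splice_pos_inj; exact: ltn_ord (j s).
rewrite -(card_imset _ pos_inj); apply: subset_leq_card.
apply/fintype.subsetP => _ /imsetP[i ij ->]; rewrite inE /=.
rewrite inE in ij; rewrite (functional_extensionality_dep (posE i)).
(* At grid position [j] every coordinate is [y s 0], so the label there is that of [x]. *)
apply: le_trans ij _; rewrite le_eqVlt; apply/orP; left; apply/eqP.
congr omega; apply/functional_extensionality_dep => s.
by rewrite /splice leqnn subnn y0.
Qed.

(** * Averaging over the grid positions of the starting point *)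

Theorem theorem7p2 (R : realType) (d : nat) (hd : (1 <= d)%N)
    (Sigma : 'I_d -> countType)
    (M : forall s, markov_chain R (Sigma s))
    (pi : forall s, Sigma s -> R)
    (hpi : forall s, stationary_distribution (M s) (pi s))
    (hrev : forall s, reversible (M s) (pi s))
    (omega : (forall s, Sigma s) -> R) (k : nat) (eps : R) (heps : 0 < eps)
    (disp : measure_display) (Omega : measurableType disp)
    (P : probability Omega R)
    (sigma0 : forall s, Omega -> Sigma s)
    (Y Z : forall s, nat -> Omega -> Sigma s)
    (hsigma0 : forall s, has_law P (sigma0 s) (pi s))
    (hY : forall s n, trajectory P (M s) n (Y s))
    (hZ : forall s n, trajectory P (M s) n (Z s))
    (hY0 : forall s, Y s 0%N = sigma0 s)
    (hZ0 : forall s, Z s 0%N = sigma0 s)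
    (hYZ : forall s, cond_independent P (sigma0 s)
       <<s process_events (Y s) >> <<s process_events (Z s) >>)
    (hindep : mutually_independent P
       (fun s => <<s process_events (Y s) `|` process_events (Z s) >>)) :
  (P [set w | outlier eps (omega (fun s => sigma0 s w))
        [seq omega x | x <- choice_vectors k (fun s => sigma0 s w)
           (fun s i => Y s i w) (fun s i => Z s i w)]]
   <= (2 ^+ d * eps)%:E)%E.
Proof.

set A := [set w | _].
(* Finite functions keep the data of a grid in a countable type, where the point probabilities
   determine the law. *)
pose V (j : {ffun 'I_d -> 'I_k.+1}) w :
    {dffun forall s, {ffun 'I_k.+1 -> Sigma s}} :=
  [ffun s => [ffun i : 'I_k.+1 => splice (j s) (Y s ^~ w) (Z s ^~ w) i]].
have mY s i : discrete_rv (Y s i) by apply: (hY s i).1.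
have mZ s i : discrete_rv (Z s i) by apply: (hZ s i).1.
have mV j : discrete_rv (V j).
  apply: (@discrete_rv_dffun _ _ _
    (fun s => {ffun 'I_k.+1 -> Sigma s} : countType)) => s.
  apply: discrete_rv_ffun => i.
  by rewrite /splice; case: (leqP i (j s)).
(* The product found here is free of [j]: all grids share one law. *)
have lawV j x : P (V j @^-1` [set x]) =
    (\prod_s (pi s (x s ord0) *
      \prod_(i < k) M s (x s (inord i)) (x s (inord i.+1))))%:E.
  pose E s := path_event (fun i w => splice (j s) (Y s ^~ w) (Z s ^~ w) i) k
    (fun i => x s (inord i)).
  have VE : V j @^-1` [set x] = \bigcap_(s in [set` [set: 'I_d]%SET]) E s.
    apply/seteqP; split=> [w /= Vx s _ i ik|w H].
      by rewrite -Vx !ffunE inordK.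
    apply/ffunP => s; apply/ffunP => i; rewrite !ffunE.
    have /= := H s; rewrite inE => /(_ isT i (ltn_ord i)) ->.
    by rewrite inord_val.
  rewrite VE (hindep [set: _]%SET E) => [|s _]; last first.
    (* [E s] splits into a [Y] event and a [Z] event, both in the joint sigma-algebra of coordinate
       [s]. *)
    rewrite /E splice_path_event ?hY0 ?hZ0 //; last exact: ltn_ord (j s).
    apply: (@measurableI _ (g_sigma_algebraType _));
      apply: path_event_process => F HF; [left|right]; exact: HF.
  congr EFin; apply: eq_big => [s|s _]; first by rewrite inE.
  rewrite /E (splice_prob _ (hrev s) (hsigma0 s) (hY s) (hZ s) (hY0 s) (hZ0 s)
    (hYZ s)) /=; last exact: ltn_ord (j s).
  by congr (pi s (x s _) * _); apply/val_inj; rewrite /= inordK.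
pose c := eps * (2 * k + 1)%:R ^+ d.
have c0 : 0 <= c by rewrite mulr_ge0 ?exprn_ge0 ?ler0n// ltW.
pose label (x : {dffun forall s, {ffun 'I_k.+1 -> Sigma s}})
  (j : {ffun 'I_d -> 'I_k.+1}) := omega (fun s => x s (j s)).
pose B j : set {dffun forall s, {ffun 'I_k.+1 -> Sigma s}} :=
  [set x | #|[pred i | label x i <= label x j]|%:R <= c].
have AB j : A `<=` V j @^-1` B j.
  move=> w Aw; rewrite /B /=.
  have := @outlier_splice_rank R d Sigma omega k eps (fun s => sigma0 s w)
    (fun s i => Y s i w) (fun s i => Z s i w) j
    (fun s => congr1 (@^~ w) (hY0 s)) Aw.
  rewrite /c; congr (_%:R <= _); apply: eq_card => i; rewrite !inE /label.
  congr (omega _ <= omega _); apply/functional_extensionality_dep => s;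
    by rewrite !ffunE.
(* [A] depends only on the finitely many list entries, gathered in the discrete variable [U];
   position 0 carries [sigma0]. *)
have mA : measurable A.
  pose U w : {dffun forall s, {ffun 'I_(2 * k + 1) -> Sigma s}} :=
    [ffun s => [ffun i : 'I_(2 * k + 1) =>
      if (i <= k)%N then Y s i w else Z s (i - k)%N w]].
  have mU : discrete_rv U.
    apply: (@discrete_rv_dffun _ _ _
      (fun s => {ffun 'I_(2 * k + 1) -> Sigma s} : countType)) => s.
    by apply: discrete_rv_ffun => i; case: (leqP i k).
  have z0 : (0 < 2 * k + 1)%N by rewrite addn1.
  pose out (x : {dffun forall s, {ffun 'I_(2 * k + 1) -> Sigma s}}) :=
    outlier eps (omega (fun s => x s (Ordinal z0)))
      [seq omega (fun s => x s (f s)) | f : {ffun 'I_d -> 'I_(2 * k + 1)}].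
  suff -> : A = U @^-1` [set x | out x] by exact: mU.
  have UE w : outlier eps (omega (fun s => sigma0 s w))
      [seq omega x | x <- choice_vectors k (fun s => sigma0 s w)
         (fun s i => Y s i w) (fun s i => Z s i w)] = out (U w).
    congr (outlier _ (omega _) _).
      by apply/functional_extensionality_dep => s; rewrite !ffunE /= hY0.
    rewrite -map_comp; apply: eq_map => f /=; congr omega.
    apply/functional_extensionality_dep => s; rewrite !ffunE nth_entries//.
    by rewrite -hY0.
  by apply/seteqP; split=> w; rewrite /A /= UE.
(* Equality of laws replaces the different grids by a single one while [B j] still varies, so ranks
   can be counted within one grid. *)
have PVB j : P (V j @^-1` B j) = P (V [ffun=> ord0] @^-1` B j).
  by apply: eq_discrete_law => // x; rewrite !lawV.
(* At every outcome, [card_rank_le] bounds by [c] the number of [j] for which the fixed grid lies in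
   [B j]. *)
have sumP : (\sum_j P (V [ffun=> ord0] @^-1` B j) <= c%:E)%E.
  apply: sum_probability_le => [j|w]; first exact: mV.
  have := card_rank_le (label (V [ffun=> ord0] w)) c0.
  congr (_ <= _); rewrite -sum1_card natr_sum big_mkcond /=.
  apply: eq_bigr => j _; rewrite indicE; case: ifPn => [jB|/negP jB].
    by rewrite mem_set.
  by rewrite memNset.
have fA : P A \is a fin_num by apply: fin_num_measure.
(* Each of the (k+1)^d positions contributes at least [P A] to the sum. *)
have : ((k.+1%:R ^+ d)%:E * P A <= c%:E)%E.
  apply: le_trans sumP.
  have -> : ((k.+1%:R ^+ d)%:E * P A =
      \sum_(j : {ffun 'I_d -> 'I_k.+1}) P A)%E.
    rewrite -(fineK fA) sumEFin sumr_const card_ffun !card_ord -natrX.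
    by rewrite -EFinM mulr_natl.
  apply: lee_sum => j _; rewrite -PVB.
  by apply: le_measure; rewrite ?inE; [exact: mA|exact: mV|exact: AB].
rewrite -(fineK fA) -EFinM !lee_fin mulrC -ler_pdivlMr; last first.
  by rewrite exprn_gt0// ltr0n.
(* Cancelling the positive [eps] leaves a comparison of [2 * k + 1] with [2 * k.+1] to the power
   [d], the source of the factor [2 ^+ d]. *)
move=> /le_trans; apply; rewrite ler_pdivrMr ?exprn_gt0 ?ltr0n//.
rewrite /c mulrAC -exprMn mulrC ler_pM2r// lerXn2r ?nnegrE//.
by rewrite -natrM ler_nat; lia.
Qed.
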